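(* Let $n\geq 3$ and let $C\in\mathbb{R}^{n\times n}$ be row-stochastic, irreducible, and with zero diagonal. Consider the single-timescale DF dynamical system $x(t+1)=F(x(t))=W(x(t))^\top x(t)$ on $\Delta_n$. Assume that the digraph $G(C)$ associated to $C$ does not have star topology and let $c^\top$ be the dominant left eigenvector of $C$. Then (i) (Equilibria) the set of fixed points of $F$ in $\Delta_n$ is $\{e_1,\dots,e_n,x^*\}$, where $x^*$ lies in the interior of the simplex $\Delta_n$ and the ordering of the entries of $x^*$ is equal to the ordering of the entries of $c$; and (ii) (Convergence) for every non-autocratic initial condition $x(0)\in\Delta_n\setminus\{e_1,\dots,e_n\}$, the self-weights $x(t)$ converge exponentially to the equilibrium configuration $x^*$ as $t\to\infty$.
   Context: $\Delta_n=\{x\in\mathbb{R}^n : x_i\geq 0 \text{ for all } i,\ \sum_i x_i=1\}$ is the simplex, its interior is the set of $x\in\Delta_n$ with all $x_i>0$, and $e_1,\dots,e_n$ are the standard basis vectors of $\mathbb{R}^n$ (autocratic configurations). For a vector $x$, $x^2=(x_1^2,\dots,x_n^2)^\top$ is the entrywise square. A matrix is row-stochastic if its entries are non-negative and each row sums to $1$. The single-timescale DF (DeGroot-Friedkin) model with relative interaction matrix $C$ is $x(t+1)=F(x(t))$, $t=0,1,2,\dots$, with $F(x)=C^\top(x-x^2)+x^2=W(x)^\top x$, where $W(x)=\operatorname{diag}(x)+(I_n-\operatorname{diag}(x))C$. The dominant left eigenvector $c^\top$ of the irreducible row-stochastic matrix $C$ is the unique row vector with $c^\top C=c^\top$ and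 $c\in\Delta_n$. Equal ordering of the entries of $x^*$ and $c$ means: for all $i,j$, $x_i^*>x_j^*$ if and only if $c_i>c_j$ (hence $x_i^*=x_j^*$ if and only if $c_i=c_j$). The digraph $G(C)$ has nodes $\{1,\dots,n\}$ and a directed edge $(i,j)$ whenever $c_{ij}>0$; it has star topology if there is a center node $i$ such that every directed edge is either from node $i$ or to node $i$. Exponential convergence $x(t)\to x^*$ means there exist $M>0$ and $\rho\in(0,1)$ (possibly depending on the trajectory) with $\|x(t)-x^*\|\leq M\rho^t$ for all $t\geq 0$. *)

(* Defs.v *)
From mathcomp Require Import all_boot all_order all_algebra perm.
From mathcomp Require Import all_classical all_reals all_analysis.

Set Implicit Arguments.
Unset Strict Implicit.
Unset Printing Implicit Defensive.

Import Order.TTheory GRing.Theory Num.Theory.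
Import numFieldNormedType.Exports.

Local Open Scope classical_set_scope.
Local Open Scope ring_scope.

(* Vectors of R^n are column vectors 'cV[R]_n; x i 0 is the i-th coordinate. *)

Definition simplex (R : realType) (n : nat) : set 'cV[R]_n :=
  [set x | (forall i, 0 <= x i 0) /\ \sum_i x i 0 = 1].

Definition simplex_interior (R : realType) (n : nat) : set 'cV[R]_n :=
  [set x | simplex x /\ forall i, 0 < x i 0].

Definition std_basis (R : realType) (n : nat) (i : 'I_n) : 'cV[R]_n :=
  delta_mx i 0.

Definition autocratic (R : realType) (n : nat) : set 'cV[R]_n :=
  [set std_basis R i | i in [set: 'I_n]].

Definition row_stochastic (R : realType) (n : nat) (A : 'M[R]_n) : Prop :=
  (forall i j, 0 <= A i j) /\ (forall i, \sum_j A i j = 1).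

Definition zero_diagonal (R : realType) (n : nat) (A : 'M[R]_n) : Prop :=
  forall i, A i i = 0.

(* A simultaneous permutation of rows and columns makes A block upper
   triangular, with square diagonal blocks of orders k and n - k, both
   positive. *)
Definition reducible (R : realType) (n : nat) (A : 'M[R]_n) : Prop :=
  exists (s : 'S_n) (k : nat),
    [/\ (0 < k)%N, (k < n)%N &
        forall i j : 'I_n, (k <= i)%N -> (j < k)%N ->
          row_perm s (col_perm s A) i j = 0].

Definition irreducible (R : realType) (n : nat) (A : 'M[R]_n) : Prop :=
  ~ reducible A.

Definition digraph (R : realType) (n : nat) (A : 'M[R]_n) : rel 'I_n :=
  fun i j => 0 < A i j.

Definition star_topology (n : nat) (e : rel 'I_n) : Prop :=
  exists i : 'I_n, forall j k : 'I_n, e j k -> j = i \/ k = i.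

(* For an irreducible row-stochastic C exactly one c satisfies this. *)
Definition dominant_left_eigenvector (R : realType) (n : nat)
    (C : 'M[R]_n) (c : 'cV[R]_n) : Prop :=
  c^T *m C = c^T /\ simplex c.

Definition entrywise_square (R : realType) (n : nat) (x : 'cV[R]_n) :
    'cV[R]_n :=
  \col_i (x i 0) ^+ 2.

Definition influence_matrix (R : realType) (n : nat) (C : 'M[R]_n)
    (x : 'cV[R]_n) : 'M[R]_n :=
  diag_mx x^T + (1%:M - diag_mx x^T) *m C.

Definition DF_map (R : realType) (n : nat) (C : 'M[R]_n) (x : 'cV[R]_n) :
    'cV[R]_n :=
  C^T *m (x - entrywise_square x) + entrywise_square x.

Lemma DF_map_influence (R : realType) (n : nat) (C : 'M[R]_n)
    (x : 'cV[R]_n) : DF_map C x = (influence_matrix C x)^T *m x.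
Proof.
have sqE : diag_mx x^T *m x = entrywise_square x.
  by apply/colP => i; rewrite mul_diag_mx !mxE expr2.
rewrite /DF_map /influence_matrix [(_ + _ *m _)^T]raddfD /= trmx_mul.
rewrite [(_ - diag_mx _)^T]raddfB /= !tr_diag_mx tr_scalar_mx.
by rewrite mulmxDl -mulmxA [(_ - diag_mx _) *m x]mulmxBl mul1mx sqE addrC.
Qed.

Definition DF_trajectory (R : realType) (n : nat) (C : 'M[R]_n)
    (x : nat -> 'cV[R]_n) : Prop :=
  forall t : nat, x t.+1 = DF_map C (x t).

Definition same_ordering (R : realType) (n : nat) (x y : 'cV[R]_n) : Prop :=
  forall i j : 'I_n, x i 0 > x j 0 <-> y i 0 > y j 0.

(* `| _ | is the maximum norm on R^n; all norms there are equivalent, so the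
   choice of norm only affects M. *)
Definition converges_exponentially (R : realType) (n : nat)
    (x : nat -> 'cV[R]_n) (y : 'cV[R]_n) : Prop :=
  exists M rho : R, [/\ 0 < M, 0 < rho < 1 &
    forall t : nat, `|x t - y| <= M * rho ^+ t].

(* Main.v *)
Require Import Defs.
From mathcomp Require Import all_boot all_order all_algebra perm.
From mathcomp Require Import all_classical all_reals all_analysis.
From mathcomp Require Import ring lra.

(** Write y_i = x_i (1 - x_i), so that F(x) = x + C^T y - y: individual i gives
    away the amount y_i of self-weight and C redistributes it.  Fixed points are
    the x for which y is invariant under C^T, that is, proportional to c; y = 0
    gives the vertices.  Four facts carry the proof.

    Lyapunov function.  Let Phi(x) = sum_i (x_i^2/2 - x_i^3/3) / c_i, whose
    partial derivatives are y_i / c_i.  With d = F(x) - x and u = C^T y = y + d,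
    Taylor expansion gives exactly
      Phi(x) - Phi(F x) = 1/2 (sum_i y_i^2/c_i - sum_i u_i^2/c_i)
                          + sum_i d_i^2 (2 x_i + F(x)_i) / (3 c_i),
    and the first bracket is nonnegative by Jensen's inequality, because C
    reversed with respect to c is a Markov kernel preserving c
    ([inflow_square], [potential_drop]).

    Persistence.  For a small enough, the set {y >= a c} is invariant under F
    ([barrier_invariant]); the absence of a star enters here, as c_i < 1/2 for
    every i ([dominant_lt_half]).  A non-autocratic trajectory becomes interior
    after finitely many steps ([trajectory_interior]), hence is trapped in such a
    set and stays away from the boundary.

    Existence.  A minimizer of Phi on such a compact invariant set is a fixed
    point, since F would otherwise decrease Phi ([equilibrium_exists]).

    Error bound.  If x and z are interior points of the simplex whose vectors y
    are proportional up to an error E, then |x - z| <= K E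
    ([proportionality_error_bound]).  With E = 0 this is uniqueness of the
    interior fixed point z.  In general it says that |x - z| is at most a multiple
    of |F(x) - x| ([distance_le_step]).

    Exponential convergence follows.  The gap V = Phi(x(t)) - Phi(z) loses at
    least eta |d|^2 at each step.  As z is a critical point of Phi on the simplex,
    |V| is at most a multiple of |x - z|^2, hence of |d|^2.  Therefore V, then
    |d|^2, then |x - z|^2 decay geometrically ([geometric_of_dissipation],
    [barrier_convergence]). *)

Set Implicit Arguments.
Unset Strict Implicit.
Unset Printing Implicit Defensive.

Import Order.TTheory GRing.Theory Num.Theory.
Import numFieldNormedType.Exports.

Local Open Scope classical_set_scope.
Local Open Scope ring_scope.

(** * Real sequences, finite families and matrix norms *)

Lemma positive_lower_bound (R : realType) (n : nat) (f : 'I_n -> R) :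
  (forall i, 0 < f i) -> exists2 e, 0 < e & forall i, e <= f i.
Proof.
move=> f0; case: (pickP [pred i : 'I_n | true]) => [i0 _|n0]; last first.
  by exists 1 => // i; have := n0 i.
case: (@Order.TotalTheory.arg_minP _ _ _ i0 predT f) => // j _ jmin.
by exists (f j) => // i; exact: jmin.
Qed.

Lemma mx_norm_le (R : realType) (m n : nat) (A : 'M[R]_(m, n)) (b : R) :
  0 <= b -> (forall i j, `|A i j| <= b) -> `|A| <= b.
Proof.
move=> b0 Ab; rewrite [leLHS]/Num.norm /= mx_normrE.
by apply/bigmax_leP; split=> // -[i j] _; exact: Ab.
Qed.

(** The two bounds give V (t+1) <= (1 - eta / K) V t.  A negative value of V would
    make it decrease at least linearly from then on, whereas V >= - K q is bounded
    below; so V is nonnegative and bounds q from above through the dissipation. *)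
Lemma geometric_of_dissipation (R : realType) (q V : nat -> R) (eta K B : R) :
  0 < eta -> 0 < K -> (forall t, 0 <= q t <= B) ->
  (forall t, V t.+1 <= V t - eta * q t) -> (forall t, `|V t| <= K * q t) ->
  exists M rho : R, [/\ 0 < M, 0 < rho < 1 & forall t, q t <= M * rho ^+ t].
Proof.
move=> eta0 K0 qB dV VK.
have V_ge0 T : 0 <= V T.
  rewrite leNgt; apply/negP => VT.
  have r0 : 0 < eta / K by rewrite divr_gt0.
  have key k : V (T + k)%N <= V T * (1 + k%:R * (eta / K)).
    elim: k => [|k IH]; first by rewrite addn0 mul0r addr0 mulr1.
    rewrite addnS; apply: (le_trans (dV _)).
    have kr : 0 <= k%:R * (eta / K) by rewrite mulr_ge0 // ltW.
    have hq : - V T <= K * q (T + k)%N.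
      apply: le_trans (VK _); rewrite ler_normr; apply/orP; right.
      rewrite lerN2; apply: (le_trans IH); nra.
    have : eta / K * - V T <= eta / K * (K * q (T + k)%N) by rewrite ler_pM2l.
    rewrite mulrA divfK ?gt_eqF // -natr1; lra.
  have p0 : 0 < - V T * (eta / K) by rewrite mulr_gt0 // oppr_gt0.
  have := archi_boundP (divr_ge0 (mulr_ge0 (ltW K0)
    (le_trans (proj1 (andP (qB 0%N))) (proj2 (andP (qB 0%N))))) (ltW p0)).
  rewrite ltr_pdivrMr //; set k := Num.bound _ => hk.
  have := key k; have := VK (T + k)%N; rewrite ler_norml => /andP[lo _].
  have : K * q (T + k)%N <= K * B by rewrite ler_pM2l //;
    case/andP: (qB (T + k)%N).
  lra.
(* K + eta in place of K keeps rho positive; |V| <= (K + eta) q still holds. *)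
pose rho := 1 - eta / (K + eta).
have Ke : 0 < K + eta by rewrite addr_gt0.
have rhoE : rho = K / (K + eta) by rewrite /rho; field; rewrite gt_eqF.
have rho0 : 0 < rho by rewrite rhoE divr_gt0.
have rho1 : rho < 1 by rewrite /rho ltrBlDr ltrDl divr_gt0.
have Vt t : V t <= V 0%N * rho ^+ t.
  elim: t => [|t IH]; first by rewrite expr0 mulr1.
  apply: (@le_trans _ _ (rho * V t)); last first.
    by rewrite exprS mulrCA ler_pM2l.
  apply: le_trans (dV t) _; rewrite /rho mulrBl mul1r lerB //.
  rewrite -mulrA ler_pM2l // mulrC ler_pdivrMr // mulrC.
  apply: le_trans (ler_norm _) _; apply: le_trans (VK t) _.
  by rewrite mulrDl lerDl mulr_ge0 ?(ltW eta0) //; case/andP: (qB t).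
exists (V 0%N / eta + 1), rho; split=> [||t]; last 1 first.
- apply: (@le_trans _ _ (V 0%N / eta * rho ^+ t)); last first.
    by rewrite ler_wpM2r ?lerDl // exprn_ge0 // ltW.
  rewrite mulrAC ler_pdivlMr // mulrC.
  have := dV t; have := V_ge0 t.+1; have := Vt t; lra.
- by apply: ltr_wpDl => //; rewrite divr_ge0 // ltW.
- by rewrite rho0.
Qed.

Lemma converges_exponentially_shift (R : realType) (n : nat)
    (x : nat -> 'cV[R]_n) (z : 'cV[R]_n) (T : nat) (B : R) :
  (forall t, `|x t - z| <= B) ->
  converges_exponentially (fun t => x (T + t)%N) z ->
  converges_exponentially x z.
Proof.
move=> xB [M [rho [M0 /andP[rho0 rho1] h]]].
have B0 : 0 <= B by apply: le_trans (xB 0%N).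
exists ((B + M) / rho ^+ T), rho; split=> [||t].
- by rewrite divr_gt0 ?exprn_gt0 // ltr_wpDl.
- by rewrite rho0.
have rT : 0 < rho ^+ T by rewrite exprn_gt0.
rewrite mulrAC ler_pdivlMr //.
have [tT|Tt] := ltnP t T.
  apply: ler_pM => //; first exact: ltW.
    by apply: le_trans (xB t) _; rewrite lerDl ltW.
  by rewrite ler_wiXn2l ?ltW // ltnW.
rewrite -(subnKC Tt) exprD; have := h (t - T)%N.
set s := `|_|; set r := rho ^+ (t - T) => sM.
have r0 : 0 <= r by rewrite exprn_ge0 // ltW.
rewrite mulrC [leRHS]mulrCA ler_pM2l //; apply: le_trans sM _.
by rewrite ler_wpM2r // lerDr.
Qed.

(** * Points of the simplex with nearly proportional outflows *)

(** A third coordinate, which exists as n >= 3, has size at least eps. *)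
Lemma pair_le (R : realType) (n : nat) (x : 'I_n -> R) (eps : R) :
  (3 <= n)%N -> 0 <= eps -> (forall i, eps <= x i) -> \sum_i x i = 1 ->
  forall i j, i != j -> x i + x j + eps <= 1.
Proof.
move=> n3 eps0 xeps sum1 i j ij.
have [l] : exists l, l \in ~: [set i; j]%SET.
  apply/set0Pn; rewrite -card_gt0 cardsCs finset.setCK card_ord cards2 ij.
  rewrite subn_gt0.
  exact: leq_trans n3.
rewrite !inE negb_or => /andP[li lj].
rewrite -sum1 (bigD1 i) //= (bigD1 j) 1?eq_sym //= (bigD1 l) /=; last first.
  by rewrite li lj.
have := xeps l; have : 0 <= \sum_(k | (k != i) && (k != j) && (k != l)) x k.
  by apply: sumr_ge0 => k _; apply: le_trans (xeps k).
lra.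
Qed.

Lemma coord_le (R : realType) (n : nat) (x : 'I_n -> R) (eps : R) :
  (3 <= n)%N -> 0 <= eps -> (forall i, eps <= x i) -> \sum_i x i = 1 ->
  forall i, x i + eps <= 1.
Proof.
move=> n3 eps0 xeps sum1 i.
have [k] : exists k, k \in ~: [set i]%SET.
  apply/set0Pn; rewrite -card_gt0 cardsCs finset.setCK card_ord cards1 subn_gt0.
  exact: leq_trans n3.
rewrite !inE eq_sym => /(pair_le n3 eps0 xeps sum1).
by have := xeps k; lra.
Qed.

(** Put d = x - z, a = 1 - x - z and b = beta - 1, so that
    a_i d_i = b z_i (1 - z_i) + e_i with |e_i| <= E.  Let a_j be the least entry of
    a; it may be negative or zero, but the other a_k are at least eps.  Solving
    for d_k with k != j and inserting the result in d_j = - sum_k d_k gives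
    b Br = - e_j - a_j sum_k e_k / a_k, where
      Br = z_j (1 - z_j) + a_j sum_k z_k (1 - z_k) / a_k
         = sum_k z_k ((1 - z_k) (1 - x_j) - z_j x_k) / a_k,
    with sums over k != j, because these z_k add up to 1 - z_j.  Every term is
    positive, as z_j < 1 - z_k and x_k < 1 - x_j.  So b, hence d, is at most a
    multiple of E. *)
Lemma proportionality_error_bound (R : realType) (n : nat) (eps : R) :
  (3 <= n)%N -> 0 < eps ->
  exists2 K : R, 0 < K & forall (x z : 'I_n -> R) (beta E : R),
    (forall i, eps <= x i) -> \sum_i x i = 1 ->
    (forall i, eps <= z i) -> \sum_i z i = 1 ->
    (forall i, `|x i * (1 - x i) - beta * (z i * (1 - z i))| <= E) ->
    forall i, `|x i - z i| <= K * E.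
Proof.
move=> n3 eps0.
pose K1 : R := (1 + n%:R / eps) / eps ^+ 3.
pose K2 : R := (K1 + 1) / eps.
have K10 : 0 < K1.
  by rewrite divr_gt0 ?exprn_gt0 // ltr_wpDr ?divr_ge0 ?(ltW eps0).
have K20 : 0 < K2 by rewrite divr_gt0 // addr_gt0.
exists ((1 + n%:R) * K2) => [|x z beta E xeps sumx zeps sumz hE].
  by rewrite mulr_gt0 // ltr_wpDr.
pose a i := 1 - x i - z i.
pose d i := x i - z i.
pose e i := x i * (1 - x i) - beta * (z i * (1 - z i)).
pose b := beta - 1.
have adE i : a i * d i = b * (z i * (1 - z i)) + e i.
  by rewrite /a /d /b /e; ring.
pose i0 : 'I_n := Ordinal n3.
have E0 : 0 <= E by apply: le_trans (hE i0).
have x_lt i : x i + eps <= 1 /\ z i + eps <= 1.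
  split; first exact: (coord_le n3 (ltW eps0) xeps sumx i).
  exact: (coord_le n3 (ltW eps0) zeps sumz i).
have a_le1 i : `|a i| <= 1.
  rewrite /a ler_norml; have [] := x_lt i.
  by have := xeps i; have := zeps i; lra.
have [j _ jmin] : exists2 j, true & forall k, a j <= a k.
  case: (@Order.TotalTheory.arg_minP _ _ _ i0 predT a) => // j _ jmin.
  by exists j => // k; exact: jmin.
(* a_j + a_k >= 2 eps by pair_le for x and z, and a_j <= a_k. *)
have a_ge k : k != j -> eps <= a k.
  move=> kj; have := jmin k.
  have := pair_le n3 (ltW eps0) xeps sumx kj.
  have := pair_le n3 (ltW eps0) zeps sumz kj.
  by rewrite /a; lra.
have dE k : k != j -> d k = b * (z k * (1 - z k) / a k) + e k / a k.
  move=> kj; have := a_ge k kj => ak.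
  have ak0 : a k != 0 by rewrite gt_eqF // (lt_le_trans eps0).
  apply: (mulfI ak0); rewrite adE; field; exact: ak0.
have sumd : d j = - \sum_(k | k != j) d k.
  have /eqP : \sum_k d k = 0 by rewrite /d sumrB sumx sumz subrr.
  by rewrite (bigD1 j) //= addr_eq0 => /eqP.
have sumz_j : \sum_(k | k != j) z k = 1 - z j.
  by apply/eqP; rewrite eq_sym subr_eq -sumz (bigD1 j) //= addrC.
pose Br := z j * (1 - z j) + a j * \sum_(k | k != j) z k * (1 - z k) / a k.
pose S := \sum_(k | k != j) e k / a k.
have bBr : b * Br = - e j - a j * S.
  have : a j * d j = - a j * \sum_(k | k != j) d k by rewrite sumd mulrN mulNr.
  rewrite (eq_bigr (fun k => b * (z k * (1 - z k) / a k) + e k / a k)) //.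
  rewrite big_split /= -mulr_sumr adE /Br /S => h.
  by move: h; set s1 := \sum_(k | _) _; set s2 := \sum_(k | _) _; lra.
have BrE : Br =
    \sum_(k | k != j) z k * (((1 - z k) * (1 - x j) - z j * x k) / a k).
  have -> : Br = \sum_(k | k != j) (z k * z j + a j * (z k * (1 - z k) / a k)).
    rewrite big_split /= -mulr_suml -mulr_sumr /Br; congr (_ + _).
    by rewrite sumz_j mulrC.
  apply: eq_bigr => k kj; have := a_ge k kj => ak.
  have ak0 : a k != 0 by rewrite gt_eqF // (lt_le_trans eps0).
  have -> : (1 - z k) * (1 - x j) - z j * x k = z j * a k + a j * (1 - z k).
    by rewrite /a; ring.
  by field.
have Br_ge : eps ^+ 3 <= Br.
  apply: (@le_trans _ _ (\sum_(k | k != j) z k * eps ^+ 2)).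
    rewrite -mulr_suml exprS ler_wpM2r ?exprn_ge0 ?(ltW eps0) //.
    by rewrite sumz_j; have [_] := x_lt j; lra.
  rewrite BrE; apply: ler_sum => k kj.
  rewrite ler_wpM2l //; first by rewrite (le_trans _ (zeps k)) // ltW.
  have ak := a_ge k kj.
  rewrite ler_pdivlMr ?(lt_le_trans eps0) //.
  apply: (@le_trans _ _ (eps ^+ 2)).
    rewrite -[leRHS]mulr1 ler_wpM2l ?exprn_ge0 ?(ltW eps0) //.
    by apply: le_trans (a_le1 k); exact: ler_norm.
  have := pair_le n3 (ltW eps0) xeps sumx kj.
  have := pair_le n3 (ltW eps0) zeps sumz kj.
  have := xeps k; have := zeps j; have := xeps j; have := zeps k.
  nra.
have SE : `|S| <= n%:R / eps * E.
  apply: le_trans (ler_norm_sum _ _ _) _.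
  apply: (@le_trans _ _ (\sum_(k : 'I_n) E / eps)); last first.
    by rewrite sumr_const card_ord -mulr_natl; lra.
  rewrite [leRHS](bigD1 j) //= ler_wpDl ?divr_ge0 ?(ltW eps0) //.
  apply: ler_sum => k kj; have ak := a_ge k kj.
  have ak0 := lt_le_trans eps0 ak.
  rewrite normrM normfV (gtr0_norm ak0).
  by apply: ler_pM => //; rewrite ?invr_ge0 ?(ltW ak0) ?lef_pV2 //; exact: hE.
have bE : `|b| <= K1 * E.
  rewrite /K1 mulrAC ler_pdivlMr ?exprn_gt0 //.
  apply: (@le_trans _ _ `|b * Br|).
    rewrite normrM ler_wpM2l // (le_trans Br_ge) // ler_norm //.
  rewrite bBr; apply: le_trans (ler_normB _ _) _.
  rewrite normrN [leRHS]mulrDl mul1r lerD //; first exact: hE.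
  rewrite normrM; apply: le_trans SE; rewrite -[leRHS]mul1r ler_wpM2r //.
have dk k : k != j -> `|d k| <= K2 * E.
  move=> kj; have ak := a_ge k kj; have ak0 := lt_le_trans eps0 ak.
  rewrite dE // mulrA -mulrDl normrM normfV (gtr0_norm ak0) ler_pdivrMr //.
  apply: (@le_trans _ _ (K1 * E + E)).
    apply: le_trans (ler_normD _ _) _; rewrite lerD //; last exact: hE.
    rewrite normrM -[leRHS]mulr1 ler_pM //.
    have [_] := x_lt k; have := zeps k => zk zk1.
    rewrite ger0_norm; first nra.
    by rewrite mulr_ge0; lra.
  have -> : K1 * E + E = K2 * E * eps by rewrite /K2; field; rewrite gt_eqF.
  by rewrite ler_wpM2l // mulr_ge0 // ltW.
move=> i; have K2E : 0 <= K2 * E by rewrite mulr_ge0 // ltW.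
have [->|ij] := eqVneq i j.
  rewrite -/(d j) sumd normrN; apply: le_trans (ler_norm_sum _ _ _) _.
  apply: (@le_trans _ _ (\sum_(k : 'I_n) K2 * E)); last first.
    rewrite sumr_const card_ord -mulr_natl; lra.
  by rewrite [leRHS](bigD1 j) //= ler_wpDl //; apply: ler_sum.
apply: le_trans (dk i ij) _; rewrite -mulrA ler_peMl // lerDl //.
Qed.

(** * Irreducible row-stochastic matrices *)

(** If Z missed an index, no edge of C would enter Z from outside, and listing the
    members of Z first would put C in block triangular form. *)
Lemma irreducible_spread (R : realType) (n : nat) (C : 'M[R]_n)
    (Z : pred 'I_n) :
  irreducible C -> (exists i, Z i) ->
  (forall i j, Z j -> C i j != 0 -> Z i) -> forall i, Z i.
Proof.
move=> irrC [j0 Zj0] spread i0; apply/negPn/negP => nZi0; apply: irrC.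
pose A := [set j | Z j]%SET.
pose s := enum A ++ enum (~: A)%SET.
have s_uniq : uniq s.
  rewrite cat_uniq !enum_uniq /= andbT; apply/hasPn => j.
  by rewrite !mem_enum inE.
have size_s : size s = n.
  by rewrite size_cat -!cardE cardsC card_ord.
pose f (i : 'I_n) := nth i0 s i.
have f_inj : injective f.
  move=> i j /eqP; rewrite nth_uniq ?size_s ?ltn_ord // => /eqP.
  exact: val_inj.
exists (perm f_inj), #|A|; split.
- by apply/card_gt0P; exists j0; rewrite inE.
- rewrite -[X in (_ < X)%N]card_ord -cardsT; apply: proper_card.
  rewrite properE finset.subsetT; apply/subsetPn; exists i0; rewrite !inE //.
move=> i j ki jk; rewrite !mxE !permE.
apply/eqP/negPn/negP => Cij.
have : f j \in A by rewrite -mem_enum /f nth_cat -cardE jk mem_nth -?cardE.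
rewrite inE => /spread/(_ Cij).
have : f i \in (~: A)%SET.
  rewrite -mem_enum /f nth_cat -cardE ltnNge ki /= mem_nth //.
  rewrite -cardE cardsCs finset.setCK card_ord.
  by rewrite ltn_sub2r // (leq_ltn_trans ki).
by rewrite !inE => /negP.
Qed.

Section Matrix.
Variables (R : realType) (n : nat) (C : 'M[R]_n) (c : 'cV[R]_n).
Hypotheses (C_stochastic : row_stochastic C) (C_irreducible : irreducible C).
Hypothesis c_dominant : dominant_left_eigenvector C c.

Lemma dominantE i : \sum_j C j i * c j 0 = c i 0.
Proof.
case: c_dominant => /matrixP/(_ 0 i) + _; rewrite !mxE => <-.
by apply: eq_bigr => j _; rewrite !mxE mulrC.
Qed.

Lemma sum_CT (y : 'I_n -> R) : \sum_i \sum_j C j i * y j = \sum_j y j.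
Proof.
rewrite exchange_big; apply: eq_bigr => j _ /=.
by rewrite -mulr_suml C_stochastic.2 mul1r.
Qed.

Lemma sum_CT_eq0 (w : 'I_n -> R) i j :
  (forall k, 0 <= w k) -> \sum_k C k j * w k = 0 -> C i j != 0 -> w i = 0.
Proof.
move=> w0 /eqP; rewrite psumr_eq0; last first.
  by move=> k _; rewrite mulr_ge0 // C_stochastic.1.
move=> /allP/(_ i (mem_index_enum _)) /=.
by rewrite mulf_eq0 => /orP[->|/eqP->].
Qed.

(** The zero set of a nonnegative invariant vector contains all in-neighbours of its
    members, so irreducibility spreads it. *)
Lemma invariant_measure_eq0 (w : 'I_n -> R) :
  (forall k, 0 <= w k) -> (forall i, \sum_j C j i * w j = w i) ->
  (exists i, w i = 0) -> forall i, w i = 0.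
Proof.
move=> w0 wC [i0 wi0] i; apply/eqP.
apply: (@irreducible_spread _ _ _ (fun k => w k == 0) C_irreducible).
  by exists i0; rewrite wi0.
move=> k j /eqP wj Ckj; apply/eqP; apply: sum_CT_eq0 Ckj => //.
by rewrite wC.
Qed.

Lemma dominant_gt0 i : 0 < c i 0.
Proof.
case: c_dominant => _ [c0 c1]; rewrite lt_def c0 andbT; apply/eqP => ci.
have cz := @invariant_measure_eq0 (fun k => c k 0) c0 dominantE
             (ex_intro _ i ci).
by move: c1 => /eqP; rewrite big1 ?(eq_sym 0) ?oner_eq0 // => k _; exact: cz.
Qed.

Lemma dominant_le1 i : c i 0 <= 1.
Proof.
case: c_dominant => _ [c0 <-]; rewrite (bigD1 i) //= lerDl.
exact: sumr_ge0.
Qed.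

(** Uniqueness in the Perron-Frobenius theorem: subtract the largest multiple of c
    that leaves a nonnegative vector; the difference vanishes somewhere, hence
    everywhere. *)
Lemma invariant_vector (v : 'I_n -> R) :
  (forall i, \sum_j C j i * v j = v i) -> exists b, forall i, v i = b * c i 0.
Proof.
case: (pickP [pred i : 'I_n | true]) => [i0 _|n0] vC; last first.
  by exists 0 => i; have := n0 i.
pose r i := v i / c i 0.
have [j jmin] : exists j, forall k, r j <= r k.
  case: (@Order.TotalTheory.arg_minP _ _ _ i0 predT r) => // j _ jmin.
  by exists j => k; exact: jmin.
exists (r j) => i; apply/eqP; rewrite -subr_eq0; apply/eqP.
apply: (@invariant_measure_eq0 (fun k => v k - r j * c k 0)).
- by move=> k; rewrite subr_ge0 -ler_pdivlMr ?dominant_gt0 //; exact: jmin.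
- move=> k; under eq_bigr => l _ do rewrite mulrBr mulrCA.
  by rewrite sumrB -mulr_sumr dominantE vC.
- by exists j; rewrite /r divfK ?subrr // gt_eqF // dominant_gt0.
Qed.

(** A pseudo-inverse of C - 1 corrects y, by an amount linear in the residual, into an
    exactly invariant vector, which is then a multiple of c. *)
Lemma residual_bound : exists2 K : R, 0 < K &
  forall (y : 'I_n -> R) (D : R),
    (forall i, `|\sum_j C j i * y j - y i| <= D) ->
    exists b, forall i, `|y i - b * c i 0| <= K * D.
Proof.
pose A := C - 1%:M; pose P := pinvmx A.
exists (1 + \sum_i \sum_j `|P i j|).
  by rewrite ltr_pwDl // sumr_ge0 // => i _; rewrite sumr_ge0.
move=> y D yD; pose v : 'rV_n := \row_i y i.
pose e := v *m A *m P.
have eA : e *m A = v *m A by rewrite /e mulmxKpV // submxMl.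
have [|b vb] := @invariant_vector (fun i => v 0 i - e 0 i).
  move=> i; have : ((v - e) *m A) 0 i = 0 by rewrite mulmxBl eA subrr mxE.
  rewrite /A mulmxBr mulmx1 !mxE => /eqP; rewrite subr_eq0 => /eqP /= <-.
  by apply: eq_bigr => j _; rewrite !mxE mulrC.
exists b => i; rewrite -vb.
have -> : y i - (v 0 i - e 0 i) = e 0 i by rewrite [v 0 i]mxE; ring.
rewrite mxE.
have D0 : 0 <= D by apply: le_trans (yD i).
apply: le_trans (ler_norm_sum _ _ _) _.
apply: (@le_trans _ _ (\sum_j D * `|P j i|)).
  apply: ler_sum => j _; rewrite normrM ler_wpM2r //.
  apply: le_trans (yD j); rewrite /A mulmxBr mulmx1 !mxE.
  by rewrite le_eqVlt; apply/orP; left; apply/eqP; congr (`|_ - _|);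
     apply: eq_bigr => k _; rewrite mxE mulrC.
rewrite -mulr_sumr mulrC ler_wpM2r // ler_wpDl //.
apply: ler_sum => j _; rewrite (bigD1 i) //= lerDl sumr_ge0 //.
Qed.

(** Since c_i is the sum of C_ji c_j over j != i, it is at most 1 - c_i, with equality
    only if C_ji = 1 for all j != i; then every edge that does not start at i ends
    at i. *)
Lemma dominant_lt_half (C_diagonal : zero_diagonal C)
  (C_not_star : ~ star_topology (digraph C)) i : c i 0 < 1 - c i 0.
Proof.
case: (c_dominant) => _ [c0 c1].
have C_le1 j k : C j k <= 1.
  rewrite -(C_stochastic.2 j) (bigD1 k) //= lerDl sumr_ge0 // => l _.
  exact: C_stochastic.1.
have c1E : 1 - c i 0 = \sum_(j | j != i) c j 0.
  by apply/eqP; rewrite subr_eq -c1 (bigD1 i) //= addrC.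
have cE : c i 0 = \sum_(j | j != i) C j i * c j 0.
  by rewrite -[LHS]dominantE (bigD1 i) //= C_diagonal mul0r add0r.
rewrite lt_neqAle; apply/andP; split; last first.
  rewrite c1E [leLHS]cE; apply: ler_sum => j _.
  by rewrite -[leRHS]mul1r ler_wpM2r.
apply/eqP => ci; apply: C_not_star; exists i => j k ejk.
have [ji|ji] := eqVneq j i; first by left.
right; apply/eqP/negPn/negP => ki.
have : \sum_(l | l != i) (1 - C l i) * c l 0 = 0.
  under eq_bigr => l _ do rewrite mulrBl mul1r.
  by rewrite sumrB -c1E -cE -ci subrr.
move/eqP; rewrite psumr_eq0; last by move=> l _; rewrite mulr_ge0 // subr_ge0.
move/allP/(_ j (mem_index_enum _)); rewrite ji /= mulf_eq0.
rewrite (gt_eqF (dominant_gt0 j)) orbF subr_eq0 => /eqP Cji.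
have := C_stochastic.2 j; rewrite (bigD1 i) //= -Cji (bigD1 k) //=.
have : 0 <= \sum_(l | (l != i) && (l != k)) C j l.
  by apply: sumr_ge0 => l _; exact: C_stochastic.1.
move: ejk; rewrite /digraph; lra.
Qed.

End Matrix.

(** * Invariant sets and the Lyapunov function *)

(** The self-weight that individual i gives away in one step. *)
Definition outflow (R : realType) (n : nat) (x : 'cV[R]_n) (i : 'I_n) : R :=
  x i 0 * (1 - x i 0).

(** The increment F(x)_i - x_i; see [DF_step]. *)
Definition step (R : realType) (n : nat) (C : 'M[R]_n) (x : 'cV[R]_n)
    (i : 'I_n) : R :=
  \sum_j C j i * outflow x j - outflow x i.

(** Lyapunov function, with partial derivatives outflow x i / c_i. *)
Definition potential (R : realType) (n : nat) (c x : 'cV[R]_n) : R :=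
  \sum_i (x i 0 ^+ 2 / 2 - x i 0 ^+ 3 / 3) / c i 0.

(** For a > 0 the bound keeps every x_i away from 0 and from 1.  Multiples of c are
    used because C^T c = c, so that y >= a c implies C^T y >= a c. *)
Definition barrier (R : realType) (n : nat) (c : 'cV[R]_n) (a : R) :
    set 'cV[R]_n :=
  [set x | simplex x /\ forall i, a * c i 0 <= outflow x i].

Lemma simplex_le1 (R : realType) (n : nat) (x : 'cV[R]_n) i :
  simplex x -> x i 0 <= 1.
Proof.
by case=> x0 <-; rewrite (bigD1 i) //= lerDl; apply: sumr_ge0.
Qed.

Lemma outflow_ge0 (R : realType) (n : nat) (x : 'cV[R]_n) i :
  simplex x -> 0 <= outflow x i.
Proof.
by move=> sx; rewrite mulr_ge0 ?subr_ge0 ?simplex_le1 //; case: sx.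
Qed.

(** Second-order expansion at z; the cubic remainder is kept exactly. *)
Lemma potential_taylor (R : realType) (n : nat) (c x z : 'cV[R]_n) :
  potential c x - potential c z =
  \sum_i (outflow z i * (x i 0 - z i 0) +
    (x i 0 - z i 0) ^+ 2 * (1 / 2 - (2 * z i 0 + x i 0) / 3)) / c i 0.
Proof.
rewrite /potential -sumrB; apply: eq_bigr => i _; rewrite -mulrBl.
by congr (_ / _); rewrite /outflow; field.
Qed.

Section Dynamics.
Variables (R : realType) (n : nat) (C : 'M[R]_n) (c : 'cV[R]_n).
Hypotheses (C_stochastic : row_stochastic C) (C_irreducible : irreducible C).
Hypothesis c_dominant : dominant_left_eigenvector C c.

Let c_gt0 i : 0 < c i 0 := dominant_gt0 C_stochastic C_irreducible c_dominant i.

Lemma DF_coord x i :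
  DF_map C x i 0 = x i 0 ^+ 2 + \sum_j C j i * outflow x j.
Proof.
rewrite !mxE addrC; congr (_ + _); apply: eq_bigr => j _.
by rewrite !mxE /outflow; ring.
Qed.

Lemma DF_step x i : DF_map C x i 0 = x i 0 + step C x i.
Proof. by rewrite DF_coord /step /outflow; ring. Qed.

Lemma inflow_ge0 x i : simplex x -> 0 <= \sum_j C j i * outflow x j.
Proof.
move=> sx; apply: sumr_ge0 => j _.
by rewrite mulr_ge0 ?C_stochastic.1 ?outflow_ge0.
Qed.

Lemma DF_simplex x : simplex x -> simplex (DF_map C x).
Proof.
move=> sx; split=> [i|].
  by rewrite DF_coord addr_ge0 ?sqr_ge0 ?inflow_ge0.
under eq_bigr => i _ do rewrite DF_step.
by rewrite big_split /= /step sumrB sum_CT // subrr addr0; case: sx.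
Qed.

Lemma DF_std_basis i : DF_map C (std_basis R i) = std_basis R i.
Proof.
have o0 j : outflow (std_basis R i) j = 0.
  rewrite /outflow /std_basis mxE eqxx andbT.
  by case: (j == i); rewrite ?subrr ?mulr0 ?mul0r.
apply/colP => j; rewrite DF_step /step o0 subr0 big1 ?addr0 // => k _.
by rewrite o0 mulr0.
Qed.

Lemma simplex_std_basis i : simplex (std_basis R i : 'cV[R]_n).
Proof.
split=> [j|]; first by rewrite mxE ler0n.
rewrite (bigD1 i) //= big1 ?addr0 ?mxE ?eqxx // => j ji.
by rewrite mxE (negbTE ji).
Qed.

Lemma simplex_autocratic (x : 'cV[R]_n) i :
  simplex x -> x i 0 = 1 -> autocratic x.
Proof.
move=> [x0 x1] xi; exists i => //; apply/colP => j; rewrite mxE eqxx andbT.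
have [->|ji] := eqVneq j i; first by rewrite xi.
move: x1; rewrite (bigD1 i) //= xi => /eqP.
rewrite -[eqbRHS]addr0 (inj_eq (addrI 1)) psumr_eq0 //.
by move=> /allP/(_ j (mem_index_enum _)); rewrite ji => /eqP ->.
Qed.

Lemma DF_autocratic x : simplex x -> autocratic (DF_map C x) -> autocratic x.
Proof.
move=> sx [i _ /colP Fx]; apply: (@simplex_autocratic _ i) => //.
case: (sx) => x0 <-; rewrite (bigD1 i) //= big1 ?addr0 // => k ki.
have := Fx k; rewrite mxE (negbTE ki) /= DF_coord => /esym/eqP.
rewrite paddr_eq0 ?sqr_ge0 ?inflow_ge0 // sqrf_eq0 => /andP[/eqP //].
Qed.

(** A coordinate vanishes at time t+1 only if it vanishes at time t and so do all its
    in-neighbours (their outflow is zero and they are not at a vertex).  By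
    irreducibility the zero set shrinks strictly until it is empty. *)
Lemma trajectory_interior (x : nat -> 'cV[R]_n) :
  DF_trajectory C x -> (@simplex R n `\` @autocratic R n) (x 0%N) ->
  exists t, forall i, 0 < x t i 0.
Proof.
move=> Fx [s0 na0].
have st t : simplex (x t) by elim: t => // t IH; rewrite Fx; exact: DF_simplex.
have nat t : ~ autocratic (x t).
  elim: t => // t IH; rewrite Fx => h; apply: IH; exact: DF_autocratic h.
pose Z t := [set i | x t i 0 == 0]%SET.
have ZS t : Z t != finset.set0 -> (#|Z t.+1| < #|Z t|)%N.
  move=> Zt.
  have sub i : i \in Z t.+1 -> i \in Z t /\ forall k, C k i != 0 -> k \in Z t.
    rewrite !inE Fx DF_coord paddr_eq0 ?sqr_ge0 ?inflow_ge0 // sqrf_eq0.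
    move=> /andP[xi /eqP h]; split=> // k Cki; rewrite inE.
    have /eqP := sum_CT_eq0 C_stochastic (fun k => outflow_ge0 k (st t)) h Cki.
    rewrite mulf_eq0 => /orP[//|]; rewrite subr_eq0 eq_sym => /eqP xk.
    by case: (nat t); exact: simplex_autocratic xk.
  apply: proper_card; rewrite properE; apply/andP; split.
    by apply/fintype.subsetP => i /sub[].
  apply/negP => /fintype.subsetP ZZ.
  have allZ i : i \in Z t.
    apply: (@irreducible_spread _ _ _ (fun k => k \in Z t) C_irreducible).
      by case/set0Pn: Zt => k kZ; exists k.
    by move=> k j jZ Ckj; have [_] := sub _ (ZZ _ jZ); apply.
  case: (st t) => _ /eqP; rewrite big1 ?(eq_sym 0) ?oner_eq0 // => i _.
  by have := allZ i; rewrite inE => /eqP.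
have key m t : (#|Z t| <= m)%N -> exists s, Z s = finset.set0.
  elim: m t => [|m IH] t Zm.
    by exists t; apply/eqP; rewrite -cards_eq0 -leqn0.
  have [Z0|/ZS Zlt] := eqVneq (Z t) finset.set0; first by exists t.
  by apply: (IH t.+1); rewrite -ltnS (leq_trans Zlt).
have [t Zt0] := key _ _ (leqnn #|Z 0%N|).
exists t => i; rewrite lt_def; case: (st t) => -> _; rewrite andbT.
have : i \notin Z t by rewrite Zt0 finset.in_set0.
by rewrite inE.
Qed.

(** Jensen's inequality for the weights C_ji c_j / c_i, which sum to 1 over j, applied
    to the ratios y_j / c_j. *)
Lemma inflow_square (y : 'I_n -> R) i :
  (\sum_j C j i * y j) ^+ 2 / c i 0 <= \sum_j C j i * (y j ^+ 2 / c j 0).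
Proof.
(* t is the weighted mean of the ratios, whose variance is nonnegative. *)
set u := \sum_j _ * y j.
pose t := u / c i 0.
have ci := c_gt0 i.
have : 0 <= \sum_j C j i * (c j 0 * (y j / c j 0 - t) ^+ 2).
  apply: sumr_ge0 => j _.
  by rewrite mulr_ge0 ?C_stochastic.1 // mulr_ge0 ?sqr_ge0 ?ltW.
have -> : \sum_j C j i * (c j 0 * (y j / c j 0 - t) ^+ 2) =
   \sum_j (C j i * (y j ^+ 2 / c j 0) - (2 * t * (C j i * y j)
             - t ^+ 2 * (C j i * c j 0))).
  by apply: eq_bigr => j _; field; rewrite gt_eqF.
rewrite !sumrB -!mulr_sumr dominantE // -/u.
have -> : 2 * t * u - t ^+ 2 * c i 0 = u ^+ 2 / c i 0.
  by rewrite /t; field; rewrite gt_eqF.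
by rewrite subr_ge0.
Qed.

(** The Taylor terms y d + d^2 / 2 equal (u^2 - y^2) / 2 for the inflow u = y + d;
    after division by c_i their sum is nonpositive by Jensen's inequality. *)
Lemma potential_drop x :
  \sum_i step C x i ^+ 2 * ((2 * x i 0 + DF_map C x i 0) / (3 * c i 0))
  <= potential c x - potential c (DF_map C x).
Proof.
have jensen : \sum_i ((\sum_j C j i * outflow x j) ^+ 2 / c i 0) <=
              \sum_i (outflow x i ^+ 2 / c i 0).
  rewrite -(sum_CT C_stochastic (fun i => outflow x i ^+ 2 / c i 0)).
  by apply: ler_sum => i _; exact: inflow_square.
have -> : potential c x - potential c (DF_map C x) =
    \sum_i step C x i ^+ 2 * ((2 * x i 0 + DF_map C x i 0) / (3 * c i 0)) +
    (\sum_i (outflow x i ^+ 2 / c i 0) -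
     \sum_i ((\sum_j C j i * outflow x j) ^+ 2 / c i 0)) / 2.
  rewrite -opprB potential_taylor -sumrN -sumrB mulr_suml -big_split /=.
  apply: eq_bigr => i _; rewrite DF_step /step.
  by field; rewrite gt_eqF.
by rewrite lerDl; lra.
Qed.

Lemma barrier_ge (a : R) x i : 0 <= a -> barrier c a x -> a * c i 0 <= x i 0.
Proof.
move=> a0 [[x0 _] /(_ i)]; rewrite /outflow; have := x0 i; nra.
Qed.

(** The bound y >= a c gives F(x)_k >= x_k^2 + a c_k for all k, and t (1 - t)
    increases up to t = 1/2.  If F(x)_i <= 1/2, its outflow is therefore at least
    that of x_i^2 + a c_i, which is at least a c_i because x_i >= x_i^2 + a c_i.
    If F(x)_i > 1/2, the other coordinates keep 1 - F(x)_i above a (1 - c_i), which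
    suffices because a <= 1 - 2 c_i. *)
Lemma barrier_invariant (a : R) x :
  0 <= a -> a <= 1 / 2 -> (forall i, a <= 1 - 2 * c i 0) ->
  barrier c a x -> barrier c a (DF_map C x).
Proof.
move=> a0 a2 ac xa; have [sx ya] := xa.
have sF := DF_simplex sx.
split=> // i; have ci := c_gt0 i.
have F_ge k : x k 0 ^+ 2 + a * c k 0 <= DF_map C x k 0.
  rewrite DF_coord lerD2l -(dominantE c_dominant) mulr_sumr.
  apply: ler_sum => j _; rewrite mulrCA ler_wpM2l // C_stochastic.1 //.
have := F_ge i; have := ya i; rewrite /outflow.
set p := x i 0; set X := DF_map C x i 0; set q := a * c i 0 => yp Xp.
have [X2|X2] := leP X (1 / 2).
  have q0 : 0 <= q by rewrite mulr_ge0 // ltW.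
  have p1 : p ^+ 2 + q <= p by rewrite expr2; lra.
  apply: (@le_trans _ _ ((p ^+ 2 + q) * (1 - (p ^+ 2 + q)))); last by nra.
  have : 0 <= p ^+ 2 + q by rewrite addr_ge0 ?sqr_ge0.
  have : (p ^+ 2 + q) ^+ 2 <= p ^+ 2.
    by rewrite ler_sqr ?nnegrE ?addr_ge0 ?sqr_ge0 //; exact: sx.1.
  rewrite !expr2; lra.
have cE : \sum_(k | k != i) c k 0 = 1 - c i 0.
  case: (c_dominant) => _ [_ c1].
  by apply/eqP; rewrite eq_sym subr_eq -c1 (bigD1 i) //= addrC.
have w : a * (1 - c i 0) <= 1 - X.
  have -> : 1 - X = \sum_(k | k != i) DF_map C x k 0.
    by case: sF => _ h; apply/eqP; rewrite subr_eq -h (bigD1 i) //= addrC.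
  rewrite -cE mulr_sumr; apply: ler_sum => k _.
  by apply: le_trans (F_ge k); rewrite lerDr sqr_ge0.
have c1 := dominant_le1 c_dominant i.
have := ac i; set ci' := c i 0 in ci c1 w *; rewrite /q -/ci' => aci.
set w1 := a * (1 - ci') in w.
apply: (@le_trans _ _ (w1 * (1 - w1))); last first.
  have : 0 <= (1 - X - w1) * (X - w1) by rewrite mulr_ge0; lra.
  lra.
rewrite /w1 -mulrA ler_wpM2l //.
have : a * (1 - ci') ^+ 2 <= a.
  by rewrite -[leRHS]mulr1 ler_wpM2l // expr_le1 //; lra.
lra.
Qed.

End Dynamics.

(** * The interior equilibrium and convergence to it *)

(** The topological input: the barrier set is closed in the cube, hence compact.  The
    compactness theorems concern row vectors, whence the transpositions. *)
Lemma potential_min_on_barrier (R : realType) (n : nat) (c : 'cV[R]_n) (a : R) :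
  barrier c a !=set0 ->
  exists2 z, barrier c a z &
    forall x, barrier c a x -> potential c z <= potential c x.
Proof.
move=> [x0 x0a].
pose A := [set v : 'rV[R]_n | barrier c a v^T].
have coord i : continuous (fun v : 'rV[R]_n => v^T i 0).
  move=> v; under eq_fun do rewrite mxE; exact: coord_continuous.
have cM (f g : 'rV[R]_n -> R) : continuous f -> continuous g ->
    continuous (fun v => f v * g v).
  by move=> fc gc v; exact: (continuousM (fc v) (gc v)).
have cB (f g : 'rV[R]_n -> R) : continuous f -> continuous g ->
    continuous (fun v => f v - g v).
  by move=> fc gc v; exact: (continuousB (fc v) (gc v)).
have cC (k : R) : continuous (fun _ : 'rV[R]_n => k) by exact: cst_continuous.
have osub i : continuous (fun v : 'rV[R]_n => outflow v^T i).
  by apply: cM => //; exact: cB.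
have sumc (F : 'I_n -> 'rV[R]_n -> R) :
    (forall i, continuous (F i)) -> continuous (fun v => \sum_i F i v).
  by move=> Fc; apply: continuous_big => //; exact: add_continuous.
have A_closed : closed A.
  have -> : A = (\bigcap_i [set v : 'rV[R]_n | 0 <= v^T i 0]) `&`
     [set v : 'rV[R]_n | \sum_i v^T i 0 = 1] `&`
     (\bigcap_i [set v : 'rV[R]_n | a * c i 0 <= outflow v^T i]).
    apply/seteqP; split=> v.
      case=> -[h1 h2] h3; split; last by move=> i _; exact: h3.
      by split=> // i _; exact: h1.
    case=> -[h1 h2] h3; split; last by move=> i; exact: h3.
    by split=> // i; exact: h1.
  apply: closedI; first apply: closedI.
  - apply: closed_bigI => i _.
    apply: (@preimage_closed _ _ (fun v : 'rV[R]_n => v^T i 0)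
      [set x | 0 <= x]).
      by move=> v _; exact: coord.
    exact: closed_ge.
  - apply: (@preimage_closed _ _ (fun v : 'rV[R]_n => \sum_i v^T i 0)
      [set x | x = 1]).
      by move=> v _; exact: sumc.
    exact: closed_eq.
  - apply: closed_bigI => i _.
    apply: (@preimage_closed _ _ (fun v : 'rV[R]_n => outflow v^T i)
      [set x | a * c i 0 <= x]).
      by move=> v _; exact: osub.
    exact: closed_ge.
have A_compact : compact A.
  have box : compact [set v : 'rV[R]_n | forall i, v ord0 i \in `[0, 1]].
    apply: (@rV_compact R n (fun=> `[0, 1]%classic)) => i.
    exact: segment_compact.
  apply: (subclosed_compact A_closed box).
  move=> v [sv _] i /=; rewrite in_itv /=; have := simplex_le1 i sv.
  by case: sv => /(_ i); rewrite mxE => -> _ ->.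
have [||v vA vmin] := @EVT_min_rV R n (fun v => potential c v^T) A _ A_compact.
- by exists x0^T; rewrite /A /= trmxK.
- apply/continuous_subspaceT/sumc => i.
  apply: (cM _ _) => //; apply: (cB _ _); apply: (cM _ _) => //.
    exact: (cM _ _ (coord i) (coord i)).
  exact: (cM _ _ (coord i) (cM _ _ (coord i) (coord i))).
exists v^T; first by rewrite inE in vA.
move=> x xa; rewrite -[x]trmxK; apply: vmin.
by rewrite inE /A /= trmxK.
Qed.

Section Convergence.
Variables (R : realType) (n : nat) (C : 'M[R]_n) (c : 'cV[R]_n).
Hypothesis n_ge3 : (3 <= n)%N.
Hypotheses (C_stochastic : row_stochastic C) (C_irreducible : irreducible C).
Hypothesis c_dominant : dominant_left_eigenvector C c.

Let c_gt0 i : 0 < c i 0 := dominant_gt0 C_stochastic C_irreducible c_dominant i.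

(** With e the least coordinate of x, every outflow is at least e^2 because
    1 - x_i >= e. *)
Lemma barrier_of_interior (x : 'cV[R]_n) (a0 : R) :
  0 < a0 -> simplex x -> (forall i, 0 < x i 0) ->
  exists2 a, 0 < a <= a0 & barrier c a x.
Proof.
move=> a00 sx x0; have [e e0 xe] := positive_lower_bound x0.
exists (Order.min a0 (e ^+ 2)).
  by rewrite lt_min a00 exprn_gt0 //= ge_min lexx.
split=> // i; apply: (@le_trans _ _ (e ^+ 2)).
  rewrite -[leRHS]mulr1; apply: ler_pM; rewrite ?ge_min ?lexx ?orbT //.
  - by rewrite le_min ltW // sqr_ge0.
  - exact: c_dominant.2.1.
  - exact: (dominant_le1 c_dominant i).
have := coord_le n_ge3 (ltW e0) xe sx.2 i.
by rewrite /outflow expr2; have := xe i; nra.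
Qed.

Lemma potential_drop_ge (x : 'cV[R]_n) (e : R) :
  0 <= e -> simplex x -> (forall i, e <= x i 0) ->
  2 * e / 3 * \sum_i step C x i ^+ 2 <=
  potential c x - potential c (DF_map C x).
Proof.
move=> e0 sx xe.
apply: le_trans (potential_drop C_stochastic C_irreducible c_dominant x).
rewrite mulr_sumr; apply: ler_sum => i _.
rewrite mulrC ler_wpM2l ?sqr_ge0 // ler_pdivlMr ?mulr_gt0 //.
have F0 := (DF_simplex C_stochastic sx).1 i.
have := xe i; have := dominant_le1 c_dominant i; have := c_gt0 i; nra.
Qed.

Lemma DF_fixed_of_potential (x : 'cV[R]_n) :
  simplex x -> (forall i, 0 < x i 0) ->
  potential c x <= potential c (DF_map C x) -> DF_map C x = x.
Proof.
move=> sx x0 le; have [e e0 xe] := positive_lower_bound x0.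
have := potential_drop_ge (ltW e0) sx xe.
rewrite -subr_le0 in le => /le_trans/(_ le).
rewrite pmulr_rle0 ?divr_gt0 ?mulr_gt0 // => S0.
have : \sum_i step C x i ^+ 2 == 0.
  by rewrite eq_le S0 sumr_ge0 // => i _; rewrite sqr_ge0.
rewrite psumr_eq0 => [/allP S|i _]; last exact: sqr_ge0.
apply/colP => i; rewrite DF_step.
have := S i (mem_index_enum _).
by rewrite /= sqrf_eq0 => /eqP ->; rewrite addr0.
Qed.

Section Equilibrium.
Variable a0 : R.
Hypotheses (a0_gt0 : 0 < a0) (a0_half : a0 <= 1 / 2).
Hypothesis a0_c : forall i, a0 <= 1 - 2 * c i 0.

(** Minimize the potential over a barrier set containing the barycentre: F maps this
    set to itself and would lower the potential of a minimizer that it moves. *)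
Lemma equilibrium_exists : exists2 z, simplex_interior z & DF_map C z = z.
Proof.
have n0 : (0 < n)%N by exact: leq_trans n_ge3.
have [|||a /andP[a_gt0 aa0] ua] := @barrier_of_interior (const_mx n%:R^-1) a0.
- by [].
- split=> [i|]; first by rewrite mxE invr_ge0.
  under eq_bigr => i _ do rewrite mxE.
  by rewrite sumr_const card_ord -[_ *+ n]mulr_natl divff // pnatr_eq0 -lt0n.
- by move=> i; rewrite mxE invr_gt0 ltr0n.
have [|z za zmin] := @potential_min_on_barrier R n c a.
  by eexists; exact: ua.
have z0 i : 0 < z i 0.
  by apply: lt_le_trans (barrier_ge i (ltW a_gt0) za); rewrite mulr_gt0.
exists z; first by split=> //; exact: za.1.
apply: DF_fixed_of_potential => //; first exact: za.1.
apply/zmin/(barrier_invariant C_stochastic C_irreducible c_dominant) => //.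
  exact: ltW.
  exact: le_trans a0_half.
by move=> i; exact: le_trans (a0_c i).
Qed.

Variable z : 'cV[R]_n.
Hypotheses (z_interior : simplex_interior z) (z_fixed : DF_map C z = z).

Lemma equilibrium_outflow :
  exists2 alpha, 0 < alpha & forall i, outflow z i = alpha * c i 0.
Proof.
have [sz z0] := z_interior.
have [|alpha zE] :=
    invariant_vector C_stochastic C_irreducible c_dominant (v := outflow z).
  move=> i; apply/eqP; rewrite -subr_eq0 -/(step C z i).
  by have := DF_step C z i; rewrite z_fixed -[LHS]addr0 => /addrI <-.
exists alpha => //.
have [e e0 ze] := positive_lower_bound z0.
pose i0 := Ordinal n_ge3.
have := coord_le n_ge3 (ltW e0) ze sz.2 i0.
rewrite -(pmulr_lgt0 _ (c_gt0 i0)) -zE /outflow => zi1.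
by rewrite mulr_gt0 // subr_gt0; lra.
Qed.

(** A small step means that the outflow of x is nearly invariant, so nearly
    proportional to c, hence to the outflow of z. *)
Lemma distance_le_step (e : R) : 0 < e -> exists2 K : R, 0 < K &
  forall (x : 'cV[R]_n) (D : R), simplex x -> (forall i, e <= x i 0) ->
    (forall i, `|step C x i| <= D) -> forall i, `|x i 0 - z i 0| <= K * D.
Proof.
move=> e0; have [sz z0] := z_interior.
have [alpha alpha0 zE] := equilibrium_outflow.
have [ez ez0 zez] := positive_lower_bound z0.
have m0 : 0 < Order.min e ez by rewrite lt_min e0.
have [K1 K10 hK1] := proportionality_error_bound n_ge3 m0.
have [K2 K20 hK2] := residual_bound C_stochastic C_irreducible c_dominant.
exists (K1 * K2) => [|x D sx xe xD i]; first exact: mulr_gt0.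
have [b hb] := hK2 (outflow x) D xD.
rewrite -mulrA; apply: (hK1 (fun i => x i 0) (fun i => z i 0) (b / alpha)).
- by move=> k; rewrite ge_min xe.
- exact: sx.2.
- by move=> k; rewrite ge_min zez orbT.
- exact: sz.2.
move=> k; have := hb k; congr (`|_ - _| <= _).
by rewrite -/(outflow z k) zE mulrA divfK // gt_eqF.
Qed.

(** All constants come from the lower bound e on the coordinates along the trajectory;
    q is the squared length of the steps and V the potential gap to z. *)
Lemma barrier_convergence (a : R) (x : nat -> 'cV[R]_n) :
  0 < a <= a0 -> DF_trajectory C x -> barrier c a (x 0%N) ->
  converges_exponentially x z.
Proof.
move=> /andP[a_gt0 aa0] Fx x0a; have [sz z0] := z_interior.
have xa t : barrier c a (x t).
  elim: t => // t IH; rewrite Fx; apply: barrier_invariant => //.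
  - exact: ltW.
  - exact: le_trans a0_half.
  - by move=> i; exact: le_trans (a0_c i).
have sx t : simplex (x t) := (xa t).1.
have [ec ec0 cec] := positive_lower_bound c_gt0.
pose e := a * ec.
have e0 : 0 < e by exact: mulr_gt0.
have xe t i : e <= x t i 0.
  apply: le_trans (barrier_ge i (ltW a_gt0) (xa t)).
  by rewrite ler_wpM2l // ltW.
have [K K0 hK] := distance_le_step e0.
pose q t := \sum_i step C (x t) i ^+ 2.
have q0 t : 0 <= q t by apply: sumr_ge0 => i _; exact: sqr_ge0.
have step_le t i : `|step C (x t) i| <= Num.sqrt (q t).
  rewrite -sqrtr_sqr ler_wsqrtr // /q (bigD1 i) //= lerDl.
  by apply: sumr_ge0 => k _; exact: sqr_ge0.
have dist t i : `|x t i 0 - z i 0| <= K * Num.sqrt (q t).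
  exact: hK (step_le t) i.
have dist2 t i : (x t i 0 - z i 0) ^+ 2 <= K ^+ 2 * q t.
  rewrite -[q t]sqr_sqrtr // -exprMn -[leLHS]real_normK ?num_real //.
  by rewrite ler_sqr ?nnegrE // mulr_ge0 ?sqrtr_ge0 // ltW.
pose V t := potential c (x t) - potential c z.
have [alpha alpha0 zE] := equilibrium_outflow.
pose L := K ^+ 2 * \sum_i (c i 0)^-1.
have VL t : `|V t| <= L * q t.
  rewrite /V potential_taylor.
  have -> : \sum_i (outflow z i * (x t i 0 - z i 0) + (x t i 0 - z i 0) ^+ 2 *
         (1 / 2 - (2 * z i 0 + x t i 0) / 3)) / c i 0 =
     \sum_i (x t i 0 - z i 0) ^+ 2 *
       (1 / 2 - (2 * z i 0 + x t i 0) / 3) / c i 0.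
    (* z is critical on the simplex: the linear term is alpha times a zero sum. *)
    rewrite -[RHS]add0r.
    have {2}-> : 0 = \sum_i alpha * (x t i 0 - z i 0).
      by rewrite -mulr_sumr sumrB (sx t).2 sz.2 subrr mulr0.
    rewrite -big_split /=; apply: eq_bigr => i _; rewrite zE.
    by field; rewrite gt_eqF.
  apply: le_trans (ler_norm_sum _ _ _) _.
  rewrite /L mulrAC mulr_sumr; apply: ler_sum => i _.
  rewrite normrM [leRHS]mulrC [leLHS]mulrC normfV (gtr0_norm (c_gt0 i)).
  rewrite ler_wpM2l ?invr_ge0 ?(ltW (c_gt0 i)) //.
  rewrite normrM (ger0_norm (sqr_ge0 _)); apply: le_trans (dist2 t i).
  rewrite -[leRHS]mulr1 ler_wpM2l ?sqr_ge0 //.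
  have := (sx t).1 i; have := sz.1 i.
  have := simplex_le1 i (sx t); have := simplex_le1 i sz.
  by rewrite ler_norml; lra.
have L0 : 0 < L.
  rewrite mulr_gt0 ?exprn_gt0 //.
  rewrite (bigD1 (Ordinal n_ge3)) //= ltr_wpDr ?invr_gt0 //.
  by apply: sumr_ge0 => i _; rewrite invr_ge0 ltW.
have eta0 : 0 < 2 * e / 3 by rewrite divr_gt0 ?mulr_gt0.
have dV t : V t.+1 <= V t - 2 * e / 3 * q t.
  have := potential_drop_ge (ltW e0) (sx t) (xe t).
  by rewrite -Fx /V /q; lra.
have q_bound t : 0 <= q t <= n%:R.
  rewrite q0 /=; apply: (@le_trans _ _ (\sum_(i < n) 1)).
    apply: ler_sum => i _; rewrite -[leLHS]real_normK ?num_real //.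
    rewrite expr_le1 // ler_norml.
    have := DF_step C (x t) i; rewrite -Fx.
    have := (sx t).1 i; have := (sx t.+1).1 i.
    by have := simplex_le1 i (sx t); have := simplex_le1 i (sx t.+1); lra.
  by rewrite sumr_const card_ord.
have [M [rho [M0 /andP[rho0 rho1] qM]]] :=
  geometric_of_dissipation eta0 L0 q_bound dV VL.
exists (K * Num.sqrt M), (Num.sqrt rho); split=> [||t].
- by rewrite mulr_gt0 // sqrtr_gt0.
- by rewrite sqrtr_gt0 rho0 -sqrtr1 ltr_sqrt.
have b0 : 0 <= K * Num.sqrt M * Num.sqrt rho ^+ t.
  by rewrite !mulr_ge0 ?exprn_ge0 ?sqrtr_ge0 // ltW.
apply: mx_norm_le => // i j; rewrite (ord1 j) !mxE.
apply: le_trans (dist t i) _; rewrite -mulrA ler_wpM2l ?(ltW K0) //.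
rewrite -[leRHS]ger0_norm ?mulr_ge0 ?exprn_ge0 ?sqrtr_ge0 //.
rewrite -sqrtr_sqr ler_wsqrtr // exprMn sqr_sqrtr ?(ltW M0) //.
by rewrite exprAC sqr_sqrtr ?(ltW rho0).
Qed.

End Equilibrium.
End Convergence.

Theorem mainTheorem2 (R : realType) (n : nat) (hn : (3 <= n)%N)
    (C : 'M[R]_n) (c : 'cV[R]_n)
    (C_stochastic : row_stochastic C)
    (C_irreducible : irreducible C)
    (C_diagonal : zero_diagonal C)
    (C_not_star : ~ star_topology (digraph C))
    (c_dominant : dominant_left_eigenvector C c) :
  exists xstar : 'cV[R]_n,
    [/\ [set x | @simplex R n x /\ DF_map C x = x]
          = @autocratic R n `|` [set xstar],
        @simplex_interior R n xstar,
        same_ordering xstar c &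
        forall x : nat -> 'cV[R]_n,
          DF_trajectory C x ->
          (@simplex R n `\` @autocratic R n) (x 0%N) ->
          converges_exponentially x xstar].
Proof.
have gap i : 0 < 1 - 2 * c i 0.
  have := dominant_lt_half C_stochastic C_irreducible c_dominant
    C_diagonal C_not_star i.
  lra.
have [g g0 cg] := positive_lower_bound gap.
pose a0 := Order.min g (1 / 2).
have a00 : 0 < a0 by rewrite lt_min g0 divr_gt0.
have a02 : a0 <= 1 / 2 by rewrite ge_min lexx orbT.
have a0c i : a0 <= 1 - 2 * c i 0 by rewrite ge_min cg.
have [z zi Fz] := equilibrium_exists hn C_stochastic C_irreducible c_dominant
  a00 a02 a0c.
have [sz z0] := zi.
exists z; split=> //.
- apply/seteqP; split=> x /=.
    case=> sx Fx; have [xa|xna] := pselect (autocratic x); [by left|right].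
    have [t x0] := @trajectory_interior _ _ _ C_stochastic C_irreducible
      (fun=> x) (fun=> esym Fx) (conj sx xna).
    have [e e0 xe] := positive_lower_bound x0.
    have [K K0 hK] :=
      distance_le_step hn C_stochastic C_irreducible c_dominant zi Fz e0.
    apply/colP => i; apply/eqP; rewrite -subr_eq0 -normr_le0 -(mulr0 K).
    apply: hK => // k; have := DF_step C x k; rewrite Fx => /eqP.
    by rewrite -[eqbLHS]addr0 (inj_eq (addrI _)) => /eqP <-; rewrite normr0.
  case=> [[i _ <-]|->]; last by [].
  by split; [exact: simplex_std_basis | exact: DF_std_basis].
- have [alpha alpha0 zE] :=
    equilibrium_outflow hn C_stochastic C_irreducible c_dominant zi Fz.
  have [e e0 ze] := positive_lower_bound z0.
  move=> i j; have [->|ij] := eqVneq i j; first by rewrite !ltxx.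
  have zij := pair_le hn (ltW e0) ze sz.2 ij.
  have d : (z i 0 - z j 0) * (1 - z i 0 - z j 0) = alpha * (c i 0 - c j 0).
    by rewrite [RHS]mulrBr -!zE /outflow; ring.
  have p : 0 < 1 - z i 0 - z j 0 by lra.
  by rewrite -subr_gt0 -(pmulr_lgt0 _ p) d pmulr_rgt0 // subr_gt0.
move=> x Fx x0.
have [t xt] := trajectory_interior C_stochastic C_irreducible Fx x0.
have sx s : simplex (x s).
  elim: s => [|s IH]; first exact: x0.1.
  by rewrite Fx; exact: (DF_simplex C_stochastic).
have [a aa0 xa] := barrier_of_interior hn c_dominant a00 (sx t) xt.
apply: (@converges_exponentially_shift _ _ _ _ t 1) => [s|].
  apply: mx_norm_le => // i j; rewrite (ord1 j) !mxE ler_norml.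
  have := (sx s).1 i; have := sz.1 i.
  by have := simplex_le1 i (sx s); have := simplex_le1 i sz; lra.
apply: (barrier_convergence hn C_stochastic C_irreducible c_dominant
  a02 a0c zi Fz aa0).
  by move=> s; rewrite addnS Fx.
by rewrite addn0.
Qed.
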